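(* For every integer $n \geq 5$, the geodesic path number of the wheel graph $W_n$ is $$t_{gp}(W_n) = \frac{(n-1)(n+2)}{2}.$$
   Context: The wheel graph on $n$ vertices, $W_n$, is the cycle $C_{n-1}$ on $n-1$ vertices together with one additional vertex adjacent to all the vertices of $C_{n-1}$. A geodesic path in a graph $G$ is a path with at least one edge which is a shortest path in $G$ between its two end vertices; paths are undirected (a path and its reversal are the same path). The geodesic path number $t_{gp}(G)$ is the total number of geodesic paths in $G$. *)

(* Defs.v *)
From mathcomp Require Import all_boot all_order all_algebra.
Set Implicit Arguments.
Unset Strict Implicit.
Unset Printing Implicit Defensive.

Record sgraph := SGraph {
  vertex :> finType;
  adj : rel vertex;
  adj_sym : symmetric adj;
  adj_irrefl : irreflexive adj
}.
Arguments adj {s}.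

Section Paths.
Variable G : sgraph.

Definition is_path (s : seq G) : bool :=
  if s is x :: p then path adj x p && uniq s else false.

Definition ends (s : seq G) : option (G * G) :=
  if s is x :: p then Some (x, last x p) else None.

(* The vertices of a path are distinct, so sequences of at most #|G| vertices
   include all paths of G. *)
Definition geodesic (s : seq G) : bool :=
  [&& 1 < size s, is_path s &
      [forall q : #|G|.-bseq G,
         is_path q && (ends q == ends s) ==> (size s <= size q)]].

(* An undirected path is the pair of its two traversals {s, rev s}. *)
Definition t_gp : nat :=
  #|[set [set s; [bseq of rev s]] | s : #|G|.-bseq G & geodesic s]|.

End Paths.

(* The cycle C_m, for m >= 3; ordS is the successor modulo m. The condition
   i != j only matters for m = 1. *)
Definition cycle_adj (m : nat) : rel 'I_m :=
  fun i j => (i != j) && ((j == ordS i) || (i == ordS j)).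

Lemma cycle_adj_sym m : symmetric (@cycle_adj m).
Proof. by move=> i j; rewrite /cycle_adj eq_sym orbC. Qed.

Lemma cycle_adj_irrefl m : irreflexive (@cycle_adj m).
Proof. by move=> i; rewrite /cycle_adj eqxx. Qed.

Definition cycle_graph (m : nat) : sgraph :=
  SGraph (@cycle_adj_sym m) (@cycle_adj_irrefl m).

(* The graph G with one additional vertex None adjacent to all of G. *)
Definition cone_adj (G : sgraph) : rel (option G) :=
  fun u v => match u, v with
             | Some x, Some y => adj x y
             | None, None => false
             | _, _ => true
             end.

Lemma cone_adj_sym G : symmetric (@cone_adj G).
Proof. by case=> [x|] [y|] //=; rewrite adj_sym. Qed.

Lemma cone_adj_irrefl G : irreflexive (@cone_adj G).
Proof. by case=> [x|] //=; rewrite adj_irrefl. Qed.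

Definition cone (G : sgraph) : sgraph :=
  SGraph (@cone_adj_sym G) (@cone_adj_irrefl G).

Definition wheel (n : nat) : sgraph := cone (cycle_graph n.-1).

(* Main.v *)
Require Import Defs.
From mathcomp Require Import all_boot all_order all_algebra.
From mathcomp Require Import zify ring.
Set Implicit Arguments.
Unset Strict Implicit.
Unset Printing Implicit Defensive.

(** A graph of diameter at most two has only two kinds of geodesics: the edges,
    and the induced paths x - y - z.  Counting traversals (two per path) by the
    vertex y, the hub of the wheel with m = n - 1 rim vertices contributes m
    edges and m (m - 3) pairs of distinct non-adjacent rim vertices, and each of
    the m rim vertices contributes 3 edges and 2 induced paths between its rim
    neighbours, which are not adjacent because m >= 4.  This gives m (m + 3)
    traversals. *)

(** * Counting tools: orbits of an involution, sums over a cone *)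

(** The map [x |-> [set x; f x]] has fibres of size exactly two on [A], namely the orbits of [f].
    With [f] the reversal, this passes from traversals to undirected paths. *)
Lemma card_imset_pairs (T : finType) (A : {set T}) (f : T -> T) :
    involutive f -> {in A, forall x, f x \in A} -> {in A, forall x, f x != x} ->
  #|A| = #|[set [set x; f x] | x in A]| * 2.
Proof.
move=> fK fA fx; rewrite -sum1_card (partition_big_imset (fun x => [set x; f x])) /=.
rewrite -sum_nat_const; apply: eq_bigr => _ /imsetP[x Ax ->].
have <-: #|[set x; f x]| = 2 by rewrite cards2 eq_sym fx.
rewrite -sum1_card; apply: eq_bigl => y; rewrite !inE.
apply/andP/orP => [[Ay /eqP e]|].
  by have := set21 y (f y); rewrite e !inE => /orP.
by case=> /eqP ->; rewrite ?Ax ?fA // ?fK // setUC.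
Qed.

Lemma big_option (R : Type) (idx : R) (op : Monoid.com_law idx)
    (T : finType) (F : option T -> R) :
  \big[op/idx]_x F x = op (F None) (\big[op/idx]_y F (Some y)).
Proof.
rewrite (bigD1 None) //=; congr (op _ _).
rewrite (reindex_omap Some id) => [|[y|]] //=.
by apply: eq_bigl => y; rewrite eqxx.
Qed.

(** * Geodesics in graphs of diameter at most two *)

Section Geodesics.
Variable G : sgraph.
Implicit Types (s q : seq G) (x y z : G).

Lemma adj_neq x y : adj x y -> x != y.
Proof. by apply: contraTneq => ->; rewrite adj_irrefl. Qed.

Lemma is_path_size s : is_path s -> size s <= #|G|.
Proof.
by case: s => // x p /andP[_ /card_uniqP <-]; apply: max_card.
Qed.

(** Since every path fits the length bound, minimality among bounded sequences is minimality among
    all sequences. *)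
Lemma geodesicP s :
  reflect [/\ 1 < size s, is_path s &
              forall q, is_path q -> ends q = ends s -> size s <= size q]
          (geodesic s).
Proof.
apply: (iffP and3P) => -[s1 sP minS]; split=> //.
  move=> q qP qs; move/forallP/(_ (Bseq (is_path_size qP))): minS.
  by rewrite /= qP qs eqxx.
by apply/forallP=> q; apply/implyP=> /andP[qP /eqP]; apply: minS.
Qed.

Definition edge_or_induced s : bool :=
  match s with
  | [:: x; y] => adj x y
  | [:: x; y; z] => [&& adj x y, adj y z, x != z & ~~ adj x z]
  | _ => false
  end.

Hypothesis diam2 : forall x z, x != z -> ~~ adj x z -> exists2 y, adj x y & adj y z.

(** A geodesic is compared with the edge between its ends if they are adjacent, and otherwise with a
    path through a common neighbour, so it has at most three vertices. Conversely, a shorter path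
    would identify the ends or make them adjacent. *)
Lemma geodesic_diam2 s : geodesic s = edge_or_induced s.
Proof.
apply/geodesicP/idP.
  case: s => [|x [|y p]] [] //= _ /andP[/andP[xy yp] /andP[xNp up]] minS.
  have xz : x != last y p by apply: contraNneq xNp => ->; apply: mem_last.
  have [adj_xz|nadj_xz] := boolP (adj x (last y p)).
    have := minS [:: x; last y p]; rewrite /= adj_xz !inE xz => /(_ isT erefl).
    by case: p {yp xNp up minS xz adj_xz}.
  have [w xw wz] := diam2 xz nadj_xz.
  have := minS [:: x; w; last y p]; rewrite /= xw wz !inE negb_or xz !adj_neq //.
  move=> /(_ isT erefl); case: p {up xNp minS wz} yp xz nadj_xz => [|z [|t p]] //=.
  by rewrite andbT xy => -> -> ->.
case: s => [|x [|y [|z [|? ?]]]] //=.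
  move=> xy; rewrite xy !inE adj_neq //; split=> // -[|a [|b q]] //= _ [-> ya].
  by rewrite ya adj_irrefl in xy.
case/and4P=> xy yz xz nxz; rewrite xy yz !inE negb_or xz !adj_neq //.
split=> // -[|a [|b [|c q]]] //=; first by move=> _ [-> az]; rewrite az eqxx in xz.
by move=> /andP[/andP[ab _] _] [ax bz]; rewrite -ax -bz ab in nxz.
Qed.

Lemma edge_or_induced_rev s : edge_or_induced (rev s) = edge_or_induced s.
Proof.
rewrite -[s in RHS]revK; case: (rev s) => [|x [|y [|z [|t p]]]] //=.
- by rewrite adj_sym.
- rewrite (adj_sym y x) (adj_sym z y) (adj_sym z x) (eq_sym z).
  by rewrite andbCA.
- have: 3 < size (rev [:: x, y, z, t & p]) by rewrite size_rev.
  by case: (rev _) => [|? [|? [|? [|? ?]]]].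
Qed.

Lemma edge_or_induced_rev_neq s : edge_or_induced s -> rev s != s.
Proof.
case: s => [|x [|y [|z [|? ?]]]] //=.
  by move=> xy; apply/eqP=> -[yx _]; rewrite yx adj_irrefl in xy.
by case/and4P=> _ _ xz _; apply: contra xz => /eqP[->].
Qed.

(** The pairs are ordered, so that each induced path with middle [y] is counted once per
    traversal. *)
Definition induced_ends y : {set G * G} :=
  [set u | [&& adj u.1 y, adj y u.2, u.1 != u.2 & ~~ adj u.1 u.2]].

Lemma card_geodesics_diam2 :
  #|[set s : #|G|.-bseq G | geodesic s]|
  = \sum_y (#|[set x | adj x y]| + #|induced_ends y|).
Proof.
(* The second vertex comes first in the code, so that the count can be fibred over it; a traversed
   edge is thus assigned to its final vertex. The value [None] is never taken on a geodesic. *)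
pose code s : option (G * (G + G * G)) :=
  match s with
  | [:: x; y] => Some (y, inl x)
  | [:: x; y; z] => Some (y, inr (x, z))
  | _ => None
  end.
pose good (u : G * (G + G * G)) :=
  match u.2 with inl x => adj x u.1 | inr v => v \in induced_ends u.1 end.
set A := [set s : _.-bseq _ | _].
have code_inj : {in A &, injective (fun s : #|G|.-bseq G => code s)}.
  move=> s t; rewrite !inE !geodesic_diam2 => gs gt e; apply: val_inj; move: gs gt e.
  case: s t => -[|x [|y [|z [|? ?]]]] //= _ [] -[|x' [|y' [|z' [|? ?]]]] //= _ _ _.
    by case=> -> ->.
  by case=> -> -> ->.
have -> : #|A| = #|[set u | good u]|.
  rewrite -(card_in_imset code_inj) -[RHS](card_imset _ (@Some_inj _)).
  apply: eq_card => o; apply/imsetP/imsetP.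
    case=> s; rewrite inE geodesic_diam2 => + ->.
    case: s => -[|x [|y [|z [|? ?]]]] //= _ gs.
      by exists (y, inl x); rewrite ?inE.
    by exists (y, inr (x, z)); rewrite ?inE /good /= ?inE.
  case=> -[y [x|[x z]]]; rewrite !inE /good /= ?inE => gu ->.
    have gs : geodesic [:: x; y] by rewrite geodesic_diam2.
    have /geodesicP[_ /is_path_size sz _] := gs.
    by exists (Bseq sz); rewrite ?inE.
  have gs : geodesic [:: x; y; z] by rewrite geodesic_diam2.
  have /geodesicP[_ /is_path_size sz _] := gs.
  by exists (Bseq sz); rewrite ?inE.
rewrite -sum1_card (eq_bigl (fun u => good (u.1, u.2))); last first.
  by case=> y v; rewrite inE.
rewrite -(pair_big_dep xpredT (fun y v => good (y, v)) (fun _ _ => 1)) /=.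
apply: eq_bigr => y _; rewrite big_sumType /= -!sum1_card.
by congr (_ + _); apply: eq_bigl => x; rewrite inE.
Qed.

Lemma t_gp_diam2 :
  t_gp G * 2 = \sum_y (#|[set x | adj x y]| + #|induced_ends y|).
Proof.
rewrite -card_geodesics_diam2.
rewrite (@card_imset_pairs _ _ (fun s : #|G|.-bseq G => [bseq of rev s])).
- by congr (_ * 2).
- by move=> s; apply: val_inj; rewrite /= revK.
- by move=> s; rewrite !inE !geodesic_diam2 edge_or_induced_rev.
- move=> s; rewrite inE geodesic_diam2 => /edge_or_induced_rev_neq.
  by apply: contra => /eqP {2}<-.
Qed.

End Geodesics.

(** * Counting in the wheel *)

(** Distinct non-adjacent vertices both lie in the base, and the apex is a common neighbour. *)
Lemma cone_diam2 (G : sgraph) (x z : cone G) :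
  x != z -> ~~ adj x z -> exists2 y, adj x y & adj y z.
Proof. by case: x z => [x|] [z|] //= _ _; exists None. Qed.

Section Wheel.
Variable m : nat.
Hypothesis m4 : 3 < m.
Implicit Types i j : 'I_m.

Lemma ordS_val i : ordS i = (if i.+1 == m then 0 else i.+1) :> nat.
Proof.
have := ltn_ord i; rewrite /= leq_eqVlt; case: eqP => [->|_ /= /modn_small //].
by rewrite modnn.
Qed.

Lemma ordS_eq i j : (i == ordS j) = (ord_pred i == j).
Proof. by apply/eqP/eqP => [->|<-]; rewrite ?ordSK ?ord_predK. Qed.

Lemma ordS_neq i : i != ordS i.
Proof. by rewrite -(inj_eq (@ord_inj m)) ordS_val; have := ltn_ord i; case: ifP; lia. Qed.

Lemma cycle_adjE i j : cycle_adj i j = (j \in [set ordS i; ord_pred i]).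
Proof.
rewrite /cycle_adj !inE (eq_sym j (ord_pred i)) -ordS_eq.
apply: andb_idl; apply: contraTneq => <-.
by rewrite orbb ordS_neq.
Qed.

Lemma ordS_neq_pred i : ordS i != ord_pred i.
Proof.
rewrite eq_sym -ordS_eq -(inj_eq (@ord_inj m)) !ordS_val.
by have := ltn_ord i; do 2!case: ifP; lia.
Qed.

(** Adjacency would mean that one or three successor steps return to [i]; three steps do so when
    [m = 3], which [m4] excludes. *)
Lemma cycle_adj_ordS_pred i : ~~ cycle_adj (ordS i) (ord_pred i).
Proof.
rewrite cycle_adjE !inE ordSK -!ordS_eq negb_or ordS_neq andbT.
rewrite -(inj_eq (@ord_inj m)) !ordS_val.
by have := ltn_ord i; do 3!case: ifP; lia.
Qed.

Lemma card_cycle_nbhd i : #|[set ordS i; ord_pred i]| = 2.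
Proof. by rewrite cards2 ordS_neq_pred. Qed.

Let W : sgraph := cone (cycle_graph m).

Lemma card_nbhd_hub : #|[set x : W | adj x None]| = m.
Proof.
rewrite -[RHS]card_ord -[RHS](card_imset _ (@Some_inj _)); apply: eq_card => x.
apply/idP/imsetP; rewrite inE; first by case: x => // i _; exists i.
by case=> i _ ->.
Qed.

Lemma card_nbhd_rim i : #|[set x : W | adj x (Some i)]| = 3.
Proof.
have -> : [set x : W | adj x (Some i)]
          = None |: (Some @: [set ordS i; ord_pred i] : {set W}).
  apply/setP=> -[j|]; rewrite !inE //= ?(mem_imset _ _ (@Some_inj _)).
  by rewrite cycle_adj_sym cycle_adjE.
rewrite cardsU1 (card_imset _ (@Some_inj _)) card_cycle_nbhd.
by case: imsetP => // -[].
Qed.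

Lemma card_nonadj i : #|[set j | (i != j) && ~~ cycle_adj i j]| = m - 3.
Proof.
have -> : [set j | (i != j) && ~~ cycle_adj i j]
          = ~: (i |: [set ordS i; ord_pred i]).
  by apply/setP=> j; rewrite in_set cycle_adjE !inE (eq_sym i) !negb_or.
(* The closed neighbourhood has 1 + 2 vertices, [i] not being its own neighbour. *)
rewrite cardsCs setCK card_ord cardsU1 card_cycle_nbhd -cycle_adjE.
by rewrite cycle_adj_irrefl.
Qed.

Lemma card_induced_hub : #|induced_ends (None : W)| = m * (m - 3).
Proof.
pose nonadj (u : 'I_m * 'I_m) := (u.1 != u.2) && ~~ cycle_adj u.1 u.2.
have inj : injective (fun u : 'I_m * 'I_m => (Some u.1, Some u.2) : W * W).
  by move=> [i j] [i' j'] [-> ->].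
transitivity #|[set u | nonadj u]|.
  rewrite -[RHS](card_imset _ inj); apply: eq_card => -[x z].
  apply/idP/imsetP; rewrite inE /=.
    case: x z => [i|] [j|] //= /andP[ij nij]; exists (i, j) => //.
    by rewrite inE /nonadj /= nij andbT.
  by case=> -[i j]; rewrite inE => nadj [-> ->].
rewrite -sum1_card (eq_bigl (fun u => nonadj (u.1, u.2))); last first.
  by case=> i j; rewrite inE.
rewrite -(pair_big_dep xpredT (fun i j => nonadj (i, j)) (fun _ _ => 1)) /=.
rewrite -[X in X * _]card_ord -sum_nat_const; apply: eq_bigr => i _.
by rewrite -(card_nonadj i) -sum1_card; apply: eq_bigl => j; rewrite inE.
Qed.

(** The hub is adjacent to every other vertex, hence is never an end; what remains is the two rim
    neighbours of [i], in either order. *)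
Lemma card_induced_rim i : #|induced_ends (Some i : W)| = 2.
Proof.
have -> : induced_ends (Some i : W)
  = [set (Some (ordS i), Some (ord_pred i)); (Some (ord_pred i), Some (ordS i))].
  apply/setP=> -[x z]; rewrite !inE !xpair_eqE /=.
  case: x z => [j|] [k|] //=; rewrite ?andbF // (cycle_adj_sym j i) !(cycle_adjE i).
  rewrite !inE !(inj_eq (@Some_inj _)).
  have SP := negbTE (ordS_neq_pred i); have nadj := cycle_adj_ordS_pred i.
  case: (eqVneq j (ordS i)) => [->|_].
    case: (eqVneq k (ordS i)) => [->|_]; rewrite /= SP ?eqxx //.
    by case: (eqVneq k (ord_pred i)) => [->|_] //; rewrite SP nadj.
  case: (eqVneq j (ord_pred i)) => [->|_] //=.
  case: (eqVneq k (ordS i)) => [->|_]; first by rewrite (eq_sym (ord_pred i)) SP cycle_adj_sym nadj.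
  by case: (eqVneq k (ord_pred i)) => [->|_] //; rewrite eqxx.
rewrite cards2 xpair_eqE !(inj_eq (@Some_inj _)).
by rewrite (negbTE (ordS_neq_pred i)).
Qed.

Lemma t_gp_wheel : t_gp W * 2 = m * (m + 3).
Proof.
rewrite (t_gp_diam2 (@cone_diam2 _)) big_option /= card_nbhd_hub card_induced_hub.
under eq_bigr => i _ do rewrite card_nbhd_rim card_induced_rim.
(* This is m + m (m - 3) + m (3 + 2) = m (m + 3), where the truncated subtraction is exact because
   [3 < m]. *)
by rewrite sum_nat_const card_ord; nia.
Qed.

End Wheel.

Theorem theorem3p1 (n : nat) (hn : (5 <= n)%N) :
  ((t_gp (wheel n))%:R = (n%:R - 1) * (n%:R + 2) / 2 :> rat)%R.
Proof.
(* With n = m + 1, the bound [5 <= m.+1] computes to [3 < m], and m (m + 3) is (n - 1) (n + 2). *)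
case: n hn => // m m4; have /(congr1 (fun k => k%:R : rat)%R) := t_gp_wheel m4.
rewrite !GRing.natrM GRing.natrD -[m.+1]addn1 GRing.natrD addn1.
set t : rat := (t_gp _)%:R%R => e.
have -> : (t = t * 2 / 2)%R by field.
by rewrite e; field.
Qed.
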